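(* Let $\mathcal{C}$ be an additive category and let $F:\mathcal{C}\to\mathcal{C}$ be an additive covariant endofunctor. Then: (i) The categories $\mathfrak{L}_F(\mathcal{C})$, $\mathfrak{L}^b_F(\mathcal{C})$, $\mathfrak{R}_F(\mathcal{C})$ and $\mathfrak{R}^b_F(\mathcal{C})$ are additive categories. (ii) If $\mathcal{C}$ has kernels, then $\mathfrak{L}_F(\mathcal{C})$ and $\mathfrak{L}^b_F(\mathcal{C})$ also have kernels. (iii) If $\mathcal{C}$ is an abelian category and $F$ preserves cokernels, then $\mathfrak{L}_F(\mathcal{C})$ and $\mathfrak{L}^b_F(\mathcal{C})$ are abelian categories. (iv) If $\mathcal{C}$ has cokernels, then $\mathfrak{R}_F(\mathcal{C})$ and $\mathfrak{R}^b_F(\mathcal{C})$ also have cokernels. (v) If $\mathcal{C}$ is an abelian category and $F$ preserves kernels, then $\mathfrak{R}_F(\mathcal{C})$ and $\mathfrak{R}^b_F(\mathcal{C})$ are abelian categories. (vi) If $\mathcal{C}$ is a $\Bbbk$-category, where $\Bbbk$ is a commutative ring with unity, then $\mathfrak{L}_F(\mathcal{C})$, $\mathfrak{L}^b_F(\mathcal{C})$, $\mathfrak{R}_F(\mathcal{C})$ and $\mathfrak{R}^b_F(\mathcal{C})$ are $\Bbbk$-categories.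
   Context: The category $\mathfrak{L}_F(\mathcal{C})$: an object is a family $M=(M^n,d_M^n)_{n\in\mathbb{Z}}$ of objects $M^n$ of $\mathcal{C}$ and morphisms $d_M^n:F(M^n)\to M^{n+1}$ with $d_M^{n+1}\circ F(d_M^n)=0$ for all $n$. A morphism $\varphi:M\to N$ is a family $(\varphi^n:M^n\to N^n)_{n\in\mathbb{Z}}$ with $\varphi^{n+1}\circ d_M^n=d_N^n\circ F(\varphi^n)$ for all $n$. The category $\mathfrak{R}_F(\mathcal{C})$: an object is a family $M=(M^n,d_M^n)_{n\in\mathbb{Z}}$ of objects $M^n$ of $\mathcal{C}$ and morphisms $d_M^n:M^n\to F(M^{n+1})$ with $F(d_M^{n+1})\circ d_M^n=0$ for all $n$. A morphism $\varphi:M\to N$ is a family $(\varphi^n:M^n\to N^n)_{n\in\mathbb{Z}}$ with $F(\varphi^{n+1})\circ d_M^n=d_N^n\circ\varphi^n$ for all $n$. $\mathfrak{L}^b_F(\mathcal{C})$ (resp. $\mathfrak{R}^b_F(\mathcal{C})$) is the full subcategory of $\mathfrak{L}_F(\mathcal{C})$ (resp. $\mathfrak{R}_F(\mathcal{C})$) of objects $M$ for which almost all $M^n$ are $0$.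
   Formalization: In (vi) the functor F is additionally assumed to be k-linear on hom-sets; with F merely additive (vi) fails, e.g. for k = F_p(t), finite-dimensional k-spaces and F the Frobenius twist. *)

(* Defs.v *)
From HB Require Import structures.
From mathcomp Require Import all_boot all_order all_algebra.
From mathcomp Require Import boolp.

Set Implicit Arguments.
Unset Strict Implicit.
Unset Printing Implicit Defensive.
Import GRing.Theory.
Local Open Scope ring_scope.

Record category := Category {
  obj :> Type;
  hom : obj -> obj -> Type;
  idm : forall X, hom X X;
  compm : forall X Y Z, hom Y Z -> hom X Y -> hom X Z;
  comp1m : forall X Y (f : hom X Y), compm (idm Y) f = f;
  compm1 : forall X Y (f : hom X Y), compm f (idm X) = f;
  compmA : forall X Y Z W (h : hom Z W) (g : hom Y Z) (f : hom X Y),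
    compm h (compm g f) = compm (compm h g) f
}.
Arguments hom {c} X Y.
Arguments idm {c} X.
Arguments compm {c X Y Z} g f.

Notation "g ∘ f" := (compm g f) (at level 40, left associativity).

Definition full_subcategory (C : category) (P : C -> Prop) : category :=
  @Category {X : C | P X}
    (fun X Y => hom (proj1_sig X) (proj1_sig Y))
    (fun X => idm (proj1_sig X))
    (fun _ _ _ g f => g ∘ f)
    (fun _ _ f => comp1m f)
    (fun _ _ f => compm1 f)
    (fun _ _ _ _ h g f => compmA h g f).

Record endofunctor (C : category) := Endofunctor {
  fobj :> C -> C;
  fmap : forall X Y, hom X Y -> hom (fobj X) (fobj Y);
  fmap1 : forall X, fmap (idm X) = idm (fobj X);
  fmapM : forall X Y Z (g : hom Y Z) (f : hom X Y),
    fmap (g ∘ f) = fmap g ∘ fmap f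
}.
Arguments fmap {C} F {X Y} f : rename.

Definition is_mono (C : category) (X Y : C) (f : hom X Y) :=
  forall (W : C) (g h : hom W X), f ∘ g = f ∘ h -> g = h.

Definition is_epi (C : category) (X Y : C) (f : hom X Y) :=
  forall (W : C) (g h : hom Y W), g ∘ f = h ∘ f -> g = h.

Definition is_zero_obj (C : category) (Z : C) :=
  forall X : C, (exists f : hom Z X, forall g, g = f) /\
                (exists f : hom X Z, forall g, g = f).

(* An abelian group structure on each hom-set making composition biadditive.
   GRing.Zmodule.axioms_ T is the class packed in a zmodType of carrier T. *)
Record preadditive (C : category) := Preadditive {
  hom_class : forall X Y : C, GRing.Zmodule.axioms_ (hom X Y);
  ahom := fun X Y : C => GRing.Zmodule.Pack (hom_class X Y) : zmodType;
  compmDl : forall (X Y Z : C) (g1 g2 : ahom Y Z) (f : ahom X Y),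
    (g1 + g2 : ahom Y Z) ∘ f = (g1 ∘ f : ahom X Z) + (g2 ∘ f : ahom X Z);
  compmDr : forall (X Y Z : C) (g : ahom Y Z) (f1 f2 : ahom X Y),
    g ∘ (f1 + f2 : ahom X Y) = (g ∘ f1 : ahom X Z) + (g ∘ f2 : ahom X Z)
}.

Definition zerom (C : category) (A : preadditive C) (X Y : C) : hom X Y :=
  (0 : ahom A X Y).
Definition addm (C : category) (A : preadditive C) (X Y : C) (f g : hom X Y) :
  hom X Y := (f : ahom A X Y) + (g : ahom A X Y).
Arguments zerom {C} A {X Y}.
Arguments addm {C} A {X Y} f g.

Definition is_biproduct (C : category) (A : preadditive C) (X Y S : C)
    (i1 : hom X S) (i2 : hom Y S) (p1 : hom S X) (p2 : hom S Y) :=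
  [/\ p1 ∘ i1 = idm X, p2 ∘ i2 = idm Y, p1 ∘ i2 = zerom A, p2 ∘ i1 = zerom A
    & addm A (i1 ∘ p1) (i2 ∘ p2) = idm S].

Record additive_category (C : category) := AdditiveCategory {
  addcat_preadditive :> preadditive C;
  addcat_zero : exists Z : C, is_zero_obj Z;
  addcat_biproduct : forall X Y : C, exists (S : C)
    (i1 : hom X S) (i2 : hom Y S) (p1 : hom S X) (p2 : hom S Y),
    is_biproduct addcat_preadditive i1 i2 p1 p2
}.

Definition additive_functor (C : category) (A : preadditive C)
    (F : endofunctor C) :=
  forall (X Y : C) (f g : hom X Y),
    fmap F (addm A f g) = addm A (fmap F f) (fmap F g).

Definition is_kernel (C : category) (A : preadditive C) (X Y : C)
    (f : hom X Y) (K : C) (i : hom K X) :=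
  f ∘ i = zerom A /\
  forall (W : C) (h : hom W X), f ∘ h = zerom A ->
    exists! u : hom W K, i ∘ u = h.

Definition is_cokernel (C : category) (A : preadditive C) (X Y : C)
    (f : hom X Y) (Q : C) (p : hom Y Q) :=
  p ∘ f = zerom A /\
  forall (W : C) (h : hom Y W), h ∘ f = zerom A ->
    exists! u : hom Q W, u ∘ p = h.

Definition has_kernels (C : category) (A : preadditive C) :=
  forall (X Y : C) (f : hom X Y),
    exists (K : C) (i : hom K X), is_kernel A f i.

Definition has_cokernels (C : category) (A : preadditive C) :=
  forall (X Y : C) (f : hom X Y),
    exists (Q : C) (p : hom Y Q), is_cokernel A f p.

Definition is_abelian (C : category) (A : additive_category C) :=
  [/\ has_kernels A, has_cokernels A,
      forall (X Y : C) (f : hom X Y), is_mono f ->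
        exists (Z : C) (g : hom Y Z), is_kernel A g f
    & forall (X Y : C) (f : hom X Y), is_epi f ->
        exists (Z : C) (g : hom Z X), is_cokernel A g f].

Definition preserves_kernels (C : category) (A : preadditive C)
    (F : endofunctor C) :=
  forall (X Y : C) (f : hom X Y) (K : C) (i : hom K X),
    is_kernel A f i -> is_kernel A (fmap F f) (fmap F i).

Definition preserves_cokernels (C : category) (A : preadditive C)
    (F : endofunctor C) :=
  forall (X Y : C) (f : hom X Y) (Q : C) (p : hom Y Q),
    is_cokernel A f p -> is_cokernel A (fmap F f) (fmap F p).

(* A k-category structure whose underlying preadditive structure is A. *)
Record linear_category (k : comPzRingType) (C : category)
    (A : preadditive C) := LinearCategory {
  hom_lmod : forall X Y : C, GRing.Zmodule_isLmodule k (ahom A X Y);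
  scalem := fun (X Y : C) (a : k) (f : hom X Y) =>
    GRing.Zmodule_isLmodule.scale (hom_lmod X Y) a f : hom X Y;
  scalemAl : forall (X Y Z : C) (a : k) (g : hom Y Z) (f : hom X Y),
    scalem a (g ∘ f) = scalem a g ∘ f;
  scalemAr : forall (X Y Z : C) (a : k) (g : hom Y Z) (f : hom X Y),
    scalem a (g ∘ f) = g ∘ scalem a f
}.
Arguments scalem {k C A} K {X Y} a f : rename.

Definition linear_functor (k : comPzRingType) (C : category)
    (A : preadditive C) (K : linear_category k A) (F : endofunctor C) :=
  forall (X Y : C) (a : k) (f : hom X Y),
    fmap F (scalem K a f) = scalem K a (fmap F f).

Section TwistedComplexes.
Variables (C : category) (A : preadditive C) (F : endofunctor C).

Record Lobj := LObj {
  Lterm :> int -> C;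
  Ldiff : forall n : int, hom (F (Lterm n)) (Lterm (n + 1));
  Ldiff2 : forall n : int, Ldiff (n + 1) ∘ fmap F (Ldiff n) = zerom A
}.

Record Lhom (M N : Lobj) := LHom {
  Lcomp :> forall n : int, hom (M n) (N n);
  LcompP : forall n : int,
    Lcomp (n + 1) ∘ Ldiff M n = Ldiff N n ∘ fmap F (Lcomp n)
}.

Lemma Lhom_ext (M N : Lobj) (f g : Lhom M N) : (forall n, f n = g n) -> f = g.
Proof.
case: f g => [f fP] [g gP] /= fg; have {fg} e := functional_extensionality_dep fg.
by subst g; congr LHom; apply: Prop_irrelevance.
Qed.

Definition Lid (M : Lobj) : Lhom M M.
Proof.
by exists (fun n => idm (M n)) => n; rewrite comp1m fmap1 compm1.
Defined.

Definition Lcompm (M N P : Lobj) (g : Lhom N P) (f : Lhom M N) : Lhom M P.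
Proof.
exists (fun n => g n ∘ f n) => n.
by rewrite -compmA LcompP compmA LcompP -compmA fmapM.
Defined.

Definition Lcat : category.
Proof.
apply: (@Category Lobj Lhom Lid Lcompm).
- by move=> M N f; apply: Lhom_ext => n /=; rewrite comp1m.
- by move=> M N f; apply: Lhom_ext => n /=; rewrite compm1.
- by move=> M N P Q h g f; apply: Lhom_ext => n /=; rewrite compmA.
Defined.

Record Robj := RObj {
  Rterm :> int -> C;
  Rdiff : forall n : int, hom (Rterm n) (F (Rterm (n + 1)));
  Rdiff2 : forall n : int, fmap F (Rdiff (n + 1)) ∘ Rdiff n = zerom A
}.

Record Rhom (M N : Robj) := RHom {
  Rcomp :> forall n : int, hom (M n) (N n);
  RcompP : forall n : int,
    fmap F (Rcomp (n + 1)) ∘ Rdiff M n = Rdiff N n ∘ Rcomp n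
}.

Lemma Rhom_ext (M N : Robj) (f g : Rhom M N) : (forall n, f n = g n) -> f = g.
Proof.
case: f g => [f fP] [g gP] /= fg; have {fg} e := functional_extensionality_dep fg.
by subst g; congr RHom; apply: Prop_irrelevance.
Qed.

Definition Rid (M : Robj) : Rhom M M.
Proof.
by exists (fun n => idm (M n)) => n; rewrite fmap1 comp1m compm1.
Defined.

Definition Rcompm (M N P : Robj) (g : Rhom N P) (f : Rhom M N) : Rhom M P.
Proof.
exists (fun n => g n ∘ f n) => n.
by rewrite fmapM -compmA RcompP compmA RcompP -compmA.
Defined.

Definition Rcat : category.
Proof.
apply: (@Category Robj Rhom Rid Rcompm).
- by move=> M N f; apply: Rhom_ext => n /=; rewrite comp1m.
- by move=> M N f; apply: Rhom_ext => n /=; rewrite compm1.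
- by move=> M N P Q h g f; apply: Rhom_ext => n /=; rewrite compmA.
Defined.

Definition almost_all_zero (M : int -> C) :=
  exists s : seq int, forall n : int, n \notin s -> is_zero_obj (M n).

Definition Lbcat : category :=
  full_subcategory (fun M : Lcat => almost_all_zero (Lterm M)).

Definition Rbcat : category :=
  full_subcategory (fun M : Rcat => almost_all_zero (Rterm M)).

Definition Lcomponent (M N : Lcat) (f : hom M N) (n : int) :
  hom (Lterm M n) (Lterm N n) := Lcomp f n.

Definition Lbcomponent (M N : Lbcat) (f : hom M N) (n : int) :
  hom (Lterm (proj1_sig M) n) (Lterm (proj1_sig N) n) := Lcomp f n.

Definition Rcomponent (M N : Rcat) (f : hom M N) (n : int) :
  hom (Rterm M n) (Rterm N n) := Rcomp f n.

Definition Rbcomponent (M N : Rbcat) (f : hom M N) (n : int) :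
  hom (Rterm (proj1_sig M) n) (Rterm (proj1_sig N) n) := Rcomp f n.

End TwistedComplexes.

(* Here D is one of the four categories, T M n is the n-th object of M, and
   c f n is the n-th component of f. *)
Definition componentwise_add (C D : category) (A : preadditive C)
    (T : D -> int -> C)
    (c : forall M N : D, hom M N -> forall n : int, hom (T M n) (T N n))
    (B : preadditive D) :=
  forall (M N : D) (f g : hom M N) (n : int),
    c M N (addm B f g) n = addm A (c M N f n) (c M N g n).

Definition componentwise_scale (k : comPzRingType) (C D : category)
    (A : preadditive C) (K : linear_category k A)
    (T : D -> int -> C)
    (c : forall M N : D, hom M N -> forall n : int, hom (T M n) (T N n))
    (B : preadditive D) (L : linear_category k B) :=
  forall (M N : D) (a : k) (f : hom M N) (n : int),
    c M N (scalem L a f) n = scalem K a (c M N f n).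

(* Main.v *)
From HB Require Import structures.
Require Import Defs.
From mathcomp Require Import all_boot all_order all_algebra.
From mathcomp Require Import boolp.
(* Imported again so that hom means the hom-sets of a category. *)
Require Import Defs.

(** All four categories D consist of families of objects of C indexed by the
    integers, and a morphism of D is a family of morphisms of C subject to
    conditions; so taking terms is a faithful functor U from D to the families
    of objects of C, a [family_functor].  An equation in D may be checked
    termwise, and every part of the theorem reduces to two questions about U:
    which termwise constructions carry a differential, and which families of
    morphisms of C are morphisms of D.

    The general half assumes the answers.  If the images of the hom-sets under
    U are subgroups, D is preadditive, and termwise zero objects and biproducts
    are such in D ([lift_additive]).  If termwise kernels exist in D and
    families that factor a morphism of D through a termwise kernel are again
    morphisms, D has kernels ([termwise_has_kernels]).  A monomorphism f of D
    then has a zero kernel, computed termwise, so its terms are monomorphisms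
    of C; when C is abelian they are kernels, hence kernels of the terms of a
    termwise cokernel of f, and f is a kernel in D
    ([termwise_mono_is_kernel]).  Since a functor to families dualizes, the
    statements on cokernels and epimorphisms follow by passing to opposite
    categories.  All the assumptions pass from D to its bounded objects,
    because a subobject, a quotient and a biproduct of zero objects is zero.

    The specific half checks the assumptions.  A differential F(M^n) -> M^(n+1)
    induces one on the kernels of a morphism for any additive F, since F(i)
    is only precomposed and the universal property used is that of the kernel
    in degree n+1 ([L_kernels]).  On cokernels the induced map must start at
    F(Q^n), so F(Q^n) has to be a cokernel: this is where F is required to
    preserve cokernels ([L_cokernels]).  For a differential M^n -> F(M^(n+1))
    the roles are exchanged ([R_cokernels], [R_kernels]).  Scalars and
    differences of morphisms stay morphisms because F is linear or
    additive. *)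

Set Implicit Arguments.
Unset Strict Implicit.
Unset Printing Implicit Defensive.
Import GRing.Theory.
Local Open Scope ring_scope.

(** * Preadditive categories *)

Definition subm (C : category) (A : preadditive C) (X Y : C) (f g : hom X Y) :
  hom X Y := (f : ahom A X Y) - (g : ahom A X Y).
Arguments subm {C} A {X Y} f g.

Section Preadditive.
Variables (C : category) (A : preadditive C).

Lemma addmm0 (X Y : C) (f : hom X Y) : addm A f (zerom A) = f.
Proof. exact: (@addr0 (ahom A X Y)). Qed.

Lemma add0mm (X Y : C) (f : hom X Y) : addm A (zerom A) f = f.
Proof. exact: (@add0r (ahom A X Y)). Qed.

Lemma addmK (X Y : C) (f g : hom X Y) : subm A (addm A f g) g = f.
Proof. exact: (@addrK (ahom A X Y)). Qed.

Lemma submK (X Y : C) (f g : hom X Y) : addm A (subm A f g) g = f.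
Proof. exact: (@subrK (ahom A X Y)). Qed.

Lemma submm (X Y : C) (f : hom X Y) : subm A f f = zerom A.
Proof. exact: (@subrr (ahom A X Y)). Qed.

Lemma subm_eq0 (X Y : C) (f g : hom X Y) : subm A f g = zerom A -> f = g.
Proof. exact: (@subr0_eq (ahom A X Y)). Qed.

Lemma addm_idem (X Y : C) (f : hom X Y) : addm A f f = f -> f = zerom A.
Proof. by move=> ff; rewrite -{1}(addmK f f) ff submm. Qed.

Lemma comp_addl (X Y Z : C) (g1 g2 : hom Y Z) (f : hom X Y) :
  addm A g1 g2 ∘ f = addm A (g1 ∘ f) (g2 ∘ f).
Proof. exact: compmDl. Qed.

Lemma comp_addr (X Y Z : C) (g : hom Y Z) (f1 f2 : hom X Y) :
  g ∘ addm A f1 f2 = addm A (g ∘ f1) (g ∘ f2).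
Proof. exact: compmDr. Qed.

Lemma comp0m (X Y Z : C) (f : hom X Y) :
  (zerom A : hom Y Z) ∘ f = zerom A.
Proof. by apply: addm_idem; rewrite -comp_addl addmm0. Qed.

Lemma compm0 (X Y Z : C) (g : hom Y Z) :
  g ∘ (zerom A : hom X Y) = zerom A.
Proof. by apply: addm_idem; rewrite -comp_addr addmm0. Qed.

Lemma comp_subl (X Y Z : C) (g1 g2 : hom Y Z) (f : hom X Y) :
  subm A g1 g2 ∘ f = subm A (g1 ∘ f) (g2 ∘ f).
Proof. by rewrite -{2}(submK g1 g2) comp_addl addmK. Qed.

Lemma comp_subr (X Y Z : C) (g : hom Y Z) (f1 f2 : hom X Y) :
  g ∘ subm A f1 f2 = subm A (g ∘ f1) (g ∘ f2).
Proof. by rewrite -{2}(submK f1 f2) comp_addr addmK. Qed.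

Lemma is_zero_objP (Z : C) : is_zero_obj Z <-> idm Z = zerom A.
Proof.
split=> [/(_ Z) [[f fE] _]|idZ X]; first by rewrite (fE (idm Z)) (fE (zerom A)).
split; exists (zerom A) => g.
  by rewrite -[g]compm1 idZ compm0.
by rewrite -[g]comp1m idZ comp0m.
Qed.

Lemma mono_into_zero (X Y : C) (f : hom X Y) :
  is_mono f -> is_zero_obj Y -> is_zero_obj X.
Proof.
move=> fmono /is_zero_objP idY; apply/is_zero_objP/fmono.
by rewrite -[f]comp1m idY !comp0m.
Qed.

Lemma epi_from_zero (X Y : C) (f : hom X Y) :
  is_epi f -> is_zero_obj X -> is_zero_obj Y.
Proof.
move=> fepi /is_zero_objP idX; apply/is_zero_objP/fepi.
by rewrite -[f]compm1 idX !compm0.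
Qed.

Lemma kernel_mono (X Y : C) (f : hom X Y) (K : C) (i : hom K X) :
  is_kernel A f i -> is_mono i.
Proof.
move=> [fi0 uni] W g h igh.
have [|u [_ uE]] := uni W (i ∘ g); first by rewrite compmA fi0 comp0m.
by rewrite -(uE g) // -(uE h).
Qed.

Lemma kernel_lift (X Y : C) (f : hom X Y) (K : C) (i : hom K X) (W : C)
    (h : hom W X) :
  is_kernel A f i -> f ∘ h = zerom A -> exists u, i ∘ u = h.
Proof. by move=> [_ uni] /uni [u [uE _]]; exists u. Qed.

(** Two morphisms equalized by f differ by something that factors through
    the kernel. *)
Lemma zero_kernel_mono (X Y : C) (f : hom X Y) (K : C) (i : hom K X) :
  is_kernel A f i -> i = zerom A -> is_mono f.
Proof.
move=> ker_i i0 W g h fgh; apply: subm_eq0.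
have [|u <-] := kernel_lift (h := subm A g h) ker_i; last by rewrite i0 comp0m.
by rewrite comp_subr fgh submm.
Qed.

(** A morphism that is a kernel at all is the kernel of its own cokernel: g factors through p, so p kills no more than g does. *)
Lemma kernel_of_cokernel (X Y : C) (i : hom X Y) (Z Q : C) (g : hom Y Z)
    (p : hom Y Q) :
  is_kernel A g i -> is_cokernel A i p -> is_kernel A p i.
Proof.
move=> [gi0 uni] [pi0 pcok]; split=> // W h ph0; apply: uni.
have [t [<- _]] := pcok _ _ gi0.
by rewrite -compmA ph0 compm0.
Qed.

Lemma fmap0 (F : endofunctor C) (hF : additive_functor A F) (X Y : C) :
  fmap F (zerom A : hom X Y) = zerom A.
Proof. by apply: addm_idem; rewrite -hF addmm0. Qed.

Lemma fmap_sub (F : endofunctor C) (hF : additive_functor A F) (X Y : C)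
    (f g : hom X Y) :
  fmap F (subm A f g) = subm A (fmap F f) (fmap F g).
Proof. by rewrite -{2}(submK f g) hF addmK. Qed.

End Preadditive.

(** Opposite categories halve the work: a cokernel in C is, by conversion, a
    kernel in the opposite of C, and an epimorphism in C a monomorphism there. *)
Definition op (C : category) : category :=
  @Category C (fun X Y => hom Y X) (fun X => idm X) (fun _ _ _ g f => f ∘ g)
    (fun _ _ f => compm1 f) (fun _ _ f => comp1m f)
    (fun _ _ _ _ h g f => esym (compmA f g h)).

Definition op_preadditive (C : category) (A : preadditive C) :
    preadditive (op C) :=
  @Preadditive (op C) (fun X Y => hom_class A Y X)
    (fun X Y Z g1 g2 f => @compmDr C A Z Y X f g1 g2)
    (fun X Y Z g f1 f2 => @compmDl C A Z Y X f1 f2 g).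

Lemma cokernel_epi (C : category) (A : preadditive C) (X Y : C) (f : hom X Y)
    (Q : C) (p : hom Y Q) : is_cokernel A f p -> is_epi p.
Proof. exact: (@kernel_mono (op C) (op_preadditive A)). Qed.

Lemma cokernel_desc (C : category) (A : preadditive C) (X Y : C) (f : hom X Y)
    (Q : C) (p : hom Y Q) (W : C) (h : hom Y W) :
  is_cokernel A f p -> h ∘ f = zerom A -> exists u, u ∘ p = h.
Proof. exact: (@kernel_lift (op C) (op_preadditive A)). Qed.

(** * Categories of families *)

(** A faithful functor from D to the category of families of objects of C. *)
Record family_functor (D C : category) := FamilyFunctor {
  fam_obj :> D -> int -> C;
  fam_hom : forall M N : D, hom M N ->
    forall n : int, hom (fam_obj M n) (fam_obj N n);
  fam_hom1 : forall (M : D) n, fam_hom (idm M) n = idm (fam_obj M n);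
  fam_homM : forall (M N P : D) (g : hom N P) (f : hom M N) n,
    fam_hom (g ∘ f) n = fam_hom g n ∘ fam_hom f n;
  fam_faithful : forall (M N : D) (f g : hom M N),
    (forall n, fam_hom f n = fam_hom g n) -> f = g
}.
Arguments fam_hom {D C} U {M N} f n : rename.
Arguments fam_hom1 {D C} U M n : rename.
Arguments fam_homM {D C} U {M N P} g f n : rename.
Arguments fam_faithful {D C} U {M N f g} eq_fg : rename.

Definition op_family (D C : category) (U : family_functor D C) :
    family_functor (op D) (op C) :=
  @FamilyFunctor (op D) (op C) U (fun M N => @fam_hom D C U N M)
    (fam_hom1 U) (fun M N P g f => fam_homM U f g)
    (fun M N => @fam_faithful D C U N M).

Definition full_family (D C : category) (U : family_functor D C)
    (P : D -> Prop) : family_functor (full_subcategory P) C :=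
  @FamilyFunctor (full_subcategory P) C (fun M => U (proj1_sig M))
    (fun M N => @fam_hom D C U (proj1_sig M) (proj1_sig N))
    (fun M => fam_hom1 U (proj1_sig M))
    (fun M N P g f => fam_homM U g f)
    (fun M N => @fam_faithful D C U (proj1_sig M) (proj1_sig N)).

Section ChoiceOfFamilies.

(** Kernels, biproducts and induced maps are only known to exist; families of
    them are obtained by choosing one in each degree. *)
Lemma dependent_choice (I : Type) (T : I -> Type) (P : forall n, T n -> Prop) :
  (forall n, exists x, P n x) -> exists f : forall n, T n, forall n, P n (f n).
Proof. by move=> e; exists (fun n => sval (cid (e n))) => n; case: cid. Qed.

Variables (I : Type) (C : category).

Lemma kernel_family (A : preadditive C) (X Y : I -> C)
    (f : forall n, hom (X n) (Y n)) :
  has_kernels A ->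
  exists K (i : forall n, hom (K n) (X n)), forall n, is_kernel A (f n) (i n).
Proof.
move=> hk; have [K KP] := dependent_choice (fun n => hk _ _ (f n)).
by have [i iP] := dependent_choice KP; exists K, i.
Qed.

Lemma biproduct_family (A : additive_category C) (X Y : I -> C) :
  exists (S : I -> C) (i1 : forall n, hom (X n) (S n))
    (i2 : forall n, hom (Y n) (S n)) (p1 : forall n, hom (S n) (X n))
    (p2 : forall n, hom (S n) (Y n)),
    forall n, is_biproduct A (i1 n) (i2 n) (p1 n) (p2 n).
Proof.
have [S h1] := dependent_choice (fun n => addcat_biproduct A (X n) (Y n)).
have [i1 h2] := dependent_choice h1; have [i2 h3] := dependent_choice h2.
have [p1 h4] := dependent_choice h3; have [p2 h5] := dependent_choice h4.
by exists S, i1, i2, p1, p2.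
Qed.

End ChoiceOfFamilies.

Lemma cokernel_family (I : Type) (C : category) (A : preadditive C)
    (X Y : I -> C) (f : forall n, hom (X n) (Y n)) :
  has_cokernels A ->
  exists Q (p : forall n, hom (Y n) (Q n)), forall n, is_cokernel A (f n) (p n).
Proof.
move=> hc; apply: (@kernel_family I (op C) (op_preadditive A) Y X f).
by move=> X' Y' g; apply: hc.
Qed.

Section Lifting.
Variables (D C : category) (A : preadditive C).
Variable U : family_functor D C.

(** The images of the hom-sets are subgroups.  The zero has to be required
    separately, as it cannot be formed as f - f in an empty hom-set. *)
Definition homs_closed_under_subtraction :=
  (forall M N : D, exists z : hom M N, forall n, fam_hom U z n = zerom A) /\
  forall (M N : D) (f g : hom M N), exists h : hom M N,
    forall n, fam_hom U h n = subm A (fam_hom U f n) (fam_hom U g n).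

Definition homs_closed_under_scaling (k : comPzRingType)
    (K : linear_category k A) :=
  forall (M N : D) (a : k) (f : hom M N), exists h : hom M N,
    forall n, fam_hom U h n = scalem K a (fam_hom U f n).

Definition has_termwise_zero :=
  exists Z : D, forall n, is_zero_obj (U Z n).

Definition has_termwise_biproducts :=
  forall M N : D, exists (S : D) (i1 : hom M S) (i2 : hom N S) (p1 : hom S M)
    (p2 : hom S N), forall n, is_biproduct A (fam_hom U i1 n) (fam_hom U i2 n)
      (fam_hom U p1 n) (fam_hom U p2 n).

Definition termwise_kernel (M N K : D) (f : hom M N) (k : hom K M) :=
  forall n, is_kernel A (fam_hom U f n) (fam_hom U k n).

Definition has_termwise_kernels :=
  forall (M N : D) (f : hom M N), exists (K : D) (k : hom K M),
    termwise_kernel f k.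

(** A family of morphisms u through which a morphism of D factors termwise
    comes from D, provided that the terms of k are kernels in C.  Kernels appear
    here, and not monomorphisms, because they are what F preserves for right
    twisted complexes, where the terms of F(k) have to be cancelled. *)
Definition lifts_through_kernels :=
  forall (M K W : D) (k : hom K M) (h : hom W M)
    (u : forall n, hom (U W n) (U K n)),
    (forall n, exists (Y : C) (f : hom (U M n) Y), is_kernel A f (fam_hom U k n)) ->
    (forall n, fam_hom U k n ∘ u n = fam_hom U h n) ->
    exists v : hom W K, forall n, fam_hom U v n = u n.

End Lifting.

Section Cokernels.
Variables (D C : category) (A : preadditive C).
Variable U : family_functor D C.

Definition termwise_cokernel (M N Q : D) (f : hom M N) (p : hom N Q) :=
  forall n, is_cokernel A (fam_hom U f n) (fam_hom U p n).

Definition has_termwise_cokernels :=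
  forall (M N : D) (f : hom M N), exists (Q : D) (p : hom N Q),
    termwise_cokernel f p.

Definition descends_along_cokernels :=
  forall (N Q W : D) (p : hom N Q) (h : hom N W)
    (u : forall n, hom (U Q n) (U W n)),
    (forall n, exists (X : C) (f : hom X (U N n)),
       is_cokernel A f (fam_hom U p n)) ->
    (forall n, u n ∘ fam_hom U p n = fam_hom U h n) ->
    exists v : hom Q W, forall n, fam_hom U v n = u n.

End Cokernels.

(** * Structure lifted from families *)

Section PreadditiveStructure.
Variables (D C : category) (A : preadditive C).
Variable U : family_functor D C.
Hypothesis closed : homs_closed_under_subtraction A U.

Definition lift_zero (M N : D) : hom M N := sval (cid (closed.1 M N)).
Definition lift_sub (M N : D) (f g : hom M N) : hom M N :=
  sval (cid (closed.2 M N f g)).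
Definition lift_opp (M N : D) (f : hom M N) := lift_sub (lift_zero M N) f.
Definition lift_add (M N : D) (f g : hom M N) := lift_sub f (lift_opp g).

Lemma lift_zeroE (M N : D) n : fam_hom U (lift_zero M N) n = zerom A.
Proof. by rewrite /lift_zero; case: cid. Qed.

Lemma lift_subE (M N : D) (f g : hom M N) n :
  fam_hom U (lift_sub f g) n = subm A (fam_hom U f n) (fam_hom U g n).
Proof. by rewrite /lift_sub; case: cid. Qed.

Lemma lift_addE (M N : D) (f g : hom M N) n :
  fam_hom U (lift_add f g) n = addm A (fam_hom U f n) (fam_hom U g n).
Proof.
rewrite !lift_subE lift_zeroE /subm /addm /zerom.
by rewrite sub0r opprK.
Qed.

Let liftE := (lift_addE, lift_subE, lift_zeroE).

Lemma lift_addA (M N : D) : associative (@lift_add M N).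
Proof.
by move=> f g h; apply: (fam_faithful U) => n; rewrite !liftE /addm addrA.
Qed.

Lemma lift_addC (M N : D) : commutative (@lift_add M N).
Proof.
by move=> f g; apply: (fam_faithful U) => n; rewrite !liftE /addm addrC.
Qed.

Lemma lift_add0 (M N : D) : left_id (lift_zero M N) (@lift_add M N).
Proof.
by move=> f; apply: (fam_faithful U) => n; rewrite !liftE add0mm.
Qed.

Lemma lift_addN (M N : D) :
  left_inverse (lift_zero M N) (@lift_opp M N) (@lift_add M N).
Proof.
move=> f; apply: (fam_faithful U) => n.
by rewrite /lift_opp !liftE submK.
Qed.

(** A zmodType has decidable equality and choice, which hom-sets acquire
    classically. *)
Definition lift_choiceType (M N : D) : choiceType :=
  HB.pack_for choiceType (hom M N) (gen_eqMixin (hom M N))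
    (gen_choiceMixin (hom M N)).

Definition lift_zmodType (M N : D) : zmodType :=
  HB.pack_for zmodType (hom M N) (lift_choiceType M N)
    (GRing.isZmodule.Build (lift_choiceType M N) (@lift_addA M N)
       (@lift_addC M N) (@lift_add0 M N) (@lift_addN M N)).

Lemma lift_compDl (X Y Z : D) (g1 g2 : hom Y Z) (f : hom X Y) :
  lift_add g1 g2 ∘ f = lift_add (g1 ∘ f) (g2 ∘ f).
Proof.
apply: (fam_faithful U) => n.
by rewrite fam_homM !lift_addE !fam_homM comp_addl.
Qed.

Lemma lift_compDr (X Y Z : D) (g : hom Y Z) (f1 f2 : hom X Y) :
  g ∘ lift_add f1 f2 = lift_add (g ∘ f1) (g ∘ f2).
Proof.
apply: (fam_faithful U) => n.
by rewrite fam_homM !lift_addE !fam_homM comp_addr.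
Qed.

Definition lift_preadditive : preadditive D :=
  @Preadditive D (fun M N => GRing.Zmodule.class (lift_zmodType M N))
    lift_compDl lift_compDr.

Lemma lift_preadditive_add : componentwise_add A (@fam_hom D C U) lift_preadditive.
Proof. exact: lift_addE. Qed.

End PreadditiveStructure.

Section Termwise.
Variables (D C : category) (A : preadditive C).
Variables (U : family_functor D C) (B : preadditive D).
Hypothesis addE : componentwise_add A (@fam_hom D C U) B.

Lemma fam_hom0 (M N : D) n : fam_hom U (zerom B : hom M N) n = zerom A.
Proof. by apply: addm_idem; rewrite -addE addmm0. Qed.

Lemma termwise_zero_obj (Z : D) :
  (forall n, is_zero_obj (U Z n)) -> is_zero_obj Z.
Proof.
move=> Z0; apply/(is_zero_objP B)/(fam_faithful U) => n.
by rewrite fam_hom1 fam_hom0; apply/is_zero_objP.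
Qed.

Lemma termwise_biproduct (M N S : D) (i1 : hom M S) (i2 : hom N S)
    (p1 : hom S M) (p2 : hom S N) :
  (forall n, is_biproduct A (fam_hom U i1 n) (fam_hom U i2 n)
     (fam_hom U p1 n) (fam_hom U p2 n)) ->
  is_biproduct B i1 i2 p1 p2.
Proof.
move=> bi; split; apply: (fam_faithful U) => n; case: (bi n) => *;
  by rewrite ?addE ?fam_homM ?fam_hom1 ?fam_hom0.
Qed.

(** The termwise factorizations exist and are unique in C; the lifting property
    turns them into a morphism of D. *)
Lemma termwise_kernel_is_kernel (M N K : D) (f : hom M N) (k : hom K M) :
  lifts_through_kernels A U -> termwise_kernel A U f k -> is_kernel B f k.
Proof.
move=> lift ker; split.
  by apply: (fam_faithful U) => n; rewrite fam_homM fam_hom0 (ker n).1.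
move=> W h fh0.
have fac n : exists u, fam_hom U k n ∘ u = fam_hom U h n.
  by apply: kernel_lift (ker n) _; rewrite -fam_homM fh0 fam_hom0.
have [u uE] := dependent_choice fac.
have [|v vE] := lift M K W k h u _ uE.
  by move=> n; exists (U N n), (fam_hom U f n).
exists v; split=> [|w kw].
  by apply: (fam_faithful U) => n; rewrite fam_homM vE.
apply: (fam_faithful U) => n; apply: (kernel_mono (ker n)).
by rewrite vE uE -fam_homM kw.
Qed.

Lemma termwise_has_kernels :
  lifts_through_kernels A U -> has_termwise_kernels A U -> has_kernels B.
Proof.
move=> lift ker M N f; have [K [k kk]] := ker M N f.
by exists K, k; apply: termwise_kernel_is_kernel.
Qed.

(** Kernels in D are computed termwise, so the zero kernel of f gives each
    term of f a zero kernel. *)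
Lemma mono_termwise (M N : D) (f : hom M N) :
  has_termwise_kernels A U -> is_mono f -> forall n, is_mono (fam_hom U f n).
Proof.
move=> ker fmono n; have [K [k kk]] := ker M N f.
apply: zero_kernel_mono (kk n) _.
rewrite -(fam_hom0 K M n); congr (fam_hom U _ n); apply: fmono.
apply: (fam_faithful U) => m.
by rewrite compm0 fam_homM fam_hom0 (kk m).1.
Qed.

(** The terms of f are kernels in C, hence kernels of the terms of any termwise
    cokernel p of f; so f is a termwise kernel of p. *)
Lemma termwise_mono_is_kernel :
  lifts_through_kernels A U -> has_termwise_kernels A U ->
  has_termwise_cokernels A U ->
  (forall (X Y : C) (f : hom X Y), is_mono f ->
     exists (Z : C) (g : hom Y Z), is_kernel A g f) ->
  forall (M N : D) (f : hom M N), is_mono f ->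
    exists (Q : D) (p : hom N Q), is_kernel B p f.
Proof.
move=> lift ker coker normal M N f fmono.
have [Q [p pcok]] := coker M N f; exists Q, p.
apply: termwise_kernel_is_kernel lift _ => n.
have [Z [g fker]] := normal _ _ _ (@mono_termwise M N f ker fmono n).
exact: kernel_of_cokernel fker (pcok n).
Qed.

Section Linear.
Variables (k : comPzRingType) (K : linear_category k A).
Hypothesis closed : homs_closed_under_scaling U K.

Definition lift_scale (M N : D) (a : k) (f : hom M N) : hom M N :=
  sval (cid (closed a f)).

Lemma lift_scaleE (M N : D) (a : k) (f : hom M N) n :
  fam_hom U (lift_scale a f) n = scalem K a (fam_hom U f n).
Proof. by rewrite /lift_scale; case: cid. Qed.

Lemma lift_scaleA (M N : D) (a b : k) (f : hom M N) :
  lift_scale a (lift_scale b f) = lift_scale (a * b) f.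
Proof.
apply: (fam_faithful U) => n; rewrite !lift_scaleE.
exact: GRing.Zmodule_isLmodule.scalerA.
Qed.

Lemma lift_scale1 (M N : D) (f : hom M N) : lift_scale 1 f = f.
Proof.
apply: (fam_faithful U) => n; rewrite lift_scaleE.
exact: GRing.Zmodule_isLmodule.scale1r.
Qed.

Lemma lift_scaleDr (M N : D) (a : k) (f g : hom M N) :
  lift_scale a (addm B f g) = addm B (lift_scale a f) (lift_scale a g).
Proof.
apply: (fam_faithful U) => n; rewrite addE !lift_scaleE addE.
exact: GRing.Zmodule_isLmodule.scalerDr.
Qed.

Lemma lift_scaleDl (M N : D) (a b : k) (f : hom M N) :
  lift_scale (a + b) f = addm B (lift_scale a f) (lift_scale b f).
Proof.
apply: (fam_faithful U) => n; rewrite addE !lift_scaleE.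
exact: GRing.Zmodule_isLmodule.scalerDl.
Qed.

Lemma lift_scaleAl (M N P : D) (a : k) (g : hom N P) (f : hom M N) :
  lift_scale a (g ∘ f) = lift_scale a g ∘ f.
Proof.
apply: (fam_faithful U) => n.
by rewrite fam_homM !lift_scaleE fam_homM scalemAl.
Qed.

Lemma lift_scaleAr (M N P : D) (a : k) (g : hom N P) (f : hom M N) :
  lift_scale a (g ∘ f) = g ∘ lift_scale a f.
Proof.
apply: (fam_faithful U) => n.
by rewrite fam_homM !lift_scaleE fam_homM scalemAr.
Qed.

Definition lift_linear : linear_category k B :=
  @LinearCategory k D B
    (fun M N => GRing.Zmodule_isLmodule.Build k (ahom B M N)
       (@lift_scaleA M N) (@lift_scale1 M N) (@lift_scaleDr M N)
       (fun f a b => @lift_scaleDl M N a b f))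
    lift_scaleAl lift_scaleAr.

Lemma lift_linear_scale :
  exists L : linear_category k B, componentwise_scale K (@fam_hom D C U) L.
Proof. by exists lift_linear => M N a f n; apply: lift_scaleE. Qed.

End Linear.
End Termwise.

Lemma lift_additive (D C : category) (A : preadditive C)
    (U : family_functor D C) :
  homs_closed_under_subtraction A U -> has_termwise_zero U ->
  has_termwise_biproducts A U ->
  exists B : additive_category D, componentwise_add A (@fam_hom D C U) B.
Proof.
move=> closed [Z Z0] bi; have addE := lift_preadditive_add closed.
have zero : exists Z : D, is_zero_obj Z.
  by exists Z; apply: termwise_zero_obj addE _ Z0.
unshelve eexists (@AdditiveCategory D (lift_preadditive closed) zero _) => // M N.
have [S [i1 [i2 [p1 [p2 biS]]]]] := bi M N.
by exists S, i1, i2, p1, p2; apply: termwise_biproduct addE _ _ _ _ _ _ _ biS.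
Qed.

Section TermwiseDual.
Variables (D C : category) (A : preadditive C).
Variables (U : family_functor D C) (B : preadditive D).
Hypothesis addE : componentwise_add A (@fam_hom D C U) B.

(* The statements of this section are those of the previous one for the
   opposite categories. *)
Let op_addE : componentwise_add (op_preadditive A)
  (@fam_hom (op D) (op C) (op_family U)) (op_preadditive B).
Proof. by move=> M N f g n; apply: addE. Qed.

Lemma termwise_has_cokernels :
  descends_along_cokernels A U -> has_termwise_cokernels A U -> has_cokernels B.
Proof.
move=> desc coker M N f.
apply: (termwise_has_kernels op_addE) => [N' Q W|N' M']; first exact: desc.
exact: coker.
Qed.

Lemma termwise_epi_is_cokernel :
  descends_along_cokernels A U -> has_termwise_kernels A U ->
  has_termwise_cokernels A U ->
  (forall (X Y : C) (f : hom X Y), is_epi f ->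
     exists (Z : C) (g : hom Z X), is_cokernel A g f) ->
  forall (M N : D) (f : hom M N), is_epi f ->
    exists (K : D) (k : hom K M), is_cokernel B k f.
Proof.
move=> desc ker coker normal M N f.
apply: (termwise_mono_is_kernel op_addE) => [N' Q W|N' M'|N' M'|X Y].
- exact: desc.
- exact: coker.
- exact: ker.
- exact: normal.
Qed.

End TermwiseDual.

Lemma termwise_abelian (D C : category) (A : additive_category C)
    (U : family_functor D C) (B : additive_category D) :
  componentwise_add A (@fam_hom D C U) B ->
  lifts_through_kernels A U -> descends_along_cokernels A U ->
  has_termwise_kernels A U -> has_termwise_cokernels A U ->
  is_abelian A -> is_abelian B.
Proof.
move=> addE lift desc ker coker [_ _ nmono nepi]; split.
- exact: termwise_has_kernels addE lift ker.
- exact: termwise_has_cokernels addE desc coker.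
- exact: termwise_mono_is_kernel addE lift ker coker nmono.
- exact: termwise_epi_is_cokernel addE desc ker coker nepi.
Qed.

(** * Bounded families *)

Section Bounded.
Variables (D C : category) (A : preadditive C) (U : family_functor D C).

Let bounded (M : D) := almost_all_zero (U M).
Let Ub := full_family U bounded.

Lemma bounded_subtraction :
  homs_closed_under_subtraction A U -> homs_closed_under_subtraction A Ub.
Proof. by move=> [zero sub]; split=> M N; [apply: zero | apply: sub]. Qed.

Lemma bounded_scaling (k : comPzRingType) (K : linear_category k A) :
  homs_closed_under_scaling U K -> homs_closed_under_scaling Ub K.
Proof. by move=> scale M N; apply: scale. Qed.

Lemma bounded_zero : has_termwise_zero U -> has_termwise_zero Ub.
Proof.
move=> [Z Z0]; have bZ : bounded Z by exists [::] => n _; apply: Z0.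
by exists (exist _ Z bZ).
Qed.

Lemma bounded_biproducts :
  has_termwise_biproducts A U -> has_termwise_biproducts A Ub.
Proof.
move=> bi [M [s Ms]] [N [t Nt]]; have [S [i1 [i2 [p1 [p2 biS]]]]] := bi M N.
have bS : bounded S.
  exists (s ++ t) => n; rewrite mem_cat negb_or => /andP[ns nt].
  have [_ _ _ _ sum1] := biS n; apply/(is_zero_objP A); rewrite -sum1.
  have /(is_zero_objP A) idM := Ms n ns; have /(is_zero_objP A) idN := Nt n nt.
  by rewrite -[fam_hom U p1 n]comp1m -[fam_hom U p2 n]comp1m idM idN
    !comp0m !compm0 addmm0.
by exists (exist _ S bS), i1, i2, p1, p2.
Qed.

Lemma bounded_kernels : has_termwise_kernels A U -> has_termwise_kernels A Ub.
Proof.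
move=> ker [M [s Ms]] N f; have [K [k kk]] := ker M (proj1_sig N) f.
have bK : bounded K.
  by exists s => n ns; apply: mono_into_zero (kernel_mono (kk n)) (Ms n ns).
by exists (exist _ K bK), k.
Qed.

Lemma bounded_cokernels :
  has_termwise_cokernels A U -> has_termwise_cokernels A Ub.
Proof.
move=> coker M [N [s Ns]] f; have [Q [p pp]] := coker (proj1_sig M) N f.
have bQ : bounded Q.
  by exists s => n ns; apply: epi_from_zero (cokernel_epi (pp n)) (Ns n ns).
by exists (exist _ Q bQ), p.
Qed.

Lemma bounded_lifts : lifts_through_kernels A U -> lifts_through_kernels A Ub.
Proof. by move=> lift M K W; apply: lift. Qed.

Lemma bounded_descends :
  descends_along_cokernels A U -> descends_along_cokernels A Ub.
Proof. by move=> desc N Q W; apply: desc. Qed.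

End Bounded.

(** * Left twisted complexes *)

Section Left.
Variables (C : category) (A : preadditive C) (F : endofunctor C).
Hypothesis hF : additive_functor A F.

Definition Lfamily : family_functor (Lcat A F) C :=
  @FamilyFunctor (Lcat A F) C (fun M => Lterm M)
    (fun M N f => @Lcomponent C A F M N f)
    (fun M n => erefl) (fun M N P g f n => erefl) (@Lhom_ext C A F).

Lemma L_subtraction : homs_closed_under_subtraction A Lfamily.
Proof.
split=> [M N|M N f g].
  suff zP n : (zerom A : hom _ (Lterm N (n + 1))) ∘ Ldiff M n =
      Ldiff N n ∘ fmap F (zerom A) by exists (LHom zP).
  by rewrite fmap0 // comp0m compm0.
suff sP n : subm A (Lcomp f (n + 1)) (Lcomp g (n + 1)) ∘ Ldiff M n =
    Ldiff N n ∘ fmap F (subm A (Lcomp f n) (Lcomp g n)) by exists (LHom sP).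
by rewrite fmap_sub // comp_subl comp_subr !LcompP.
Qed.

Lemma L_scaling (k : comPzRingType) (K : linear_category k A) :
  linear_functor K F -> homs_closed_under_scaling Lfamily K.
Proof.
move=> hK M N a f.
suff sP n : scalem K a (Lcomp f (n + 1)) ∘ Ldiff M n =
    Ldiff N n ∘ fmap F (scalem K a (Lcomp f n)) by exists (LHom sP).
by rewrite hK -scalemAl -scalemAr LcompP.
Qed.

Lemma L_zero : (exists Z : C, is_zero_obj Z) -> has_termwise_zero Lfamily.
Proof.
move=> [Z Z0].
pose d (n : int) : hom (F Z) Z := zerom A.
suff dP n : d (n + 1) ∘ fmap F (d n) = zerom A by exists (LObj dP).
exact: comp0m.
Qed.

(** In degree n the induced map is the factorization of d_M F(i^n) through
    i^(n+1), which exists because f^(n+1) d_M F(i^n) = d_N F(f^n i^n) = 0.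
    Its square vanishes because it does after composition with the
    monomorphism i^(n+2). *)
Lemma L_kernels : has_kernels A -> has_termwise_kernels A Lfamily.
Proof.
move=> ker M N f; have [K [i iP]] := kernel_family (Lcomp f) ker.
have fac n : exists d, i (n + 1) ∘ d = Ldiff M n ∘ fmap F (i n).
  apply: kernel_lift (iP _) _.
  by rewrite compmA LcompP -compmA -fmapM (iP n).1 fmap0 // compm0.
have [d dE] := dependent_choice fac.
suff dP n : d (n + 1) ∘ fmap F (d n) = zerom A.
  by exists (LObj dP), (@LHom _ _ _ (LObj dP) M i dE).
apply: (kernel_mono (iP _)).
by rewrite compmA dE -compmA -fmapM dE fmapM compmA Ldiff2 comp0m compm0.
Qed.

(** Compatibility of u with the differentials may be tested after composition
    with k^(n+1), to which F is not applied. *)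
Lemma L_lifts : lifts_through_kernels A Lfamily.
Proof.
move=> M K W k h u ker uE.
suff uP n : u (n + 1) ∘ Ldiff W n = Ldiff K n ∘ fmap F (u n).
  by exists (LHom uP).
have {}uE m : Lcomp k m ∘ u m = Lcomp h m by apply: uE.
have [Y [g kg]] := ker (n + 1); apply: (kernel_mono kg).
change (Lcomp k (n + 1) ∘ (u (n + 1) ∘ Ldiff W n) =
  Lcomp k (n + 1) ∘ (Ldiff K n ∘ fmap F (u n))).
by rewrite !compmA uE !LcompP -compmA -fmapM uE.
Qed.

(** The induced map starts at F(Q^n), so it needs F(p^n) to be a cokernel of
    F(f^n).  For its square to vanish, F(F(p^n)) has to be an epimorphism. *)
Lemma L_cokernels :
  preserves_cokernels A F -> has_cokernels A -> has_termwise_cokernels A Lfamily.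
Proof.
move=> hcok coker M N f; have [Q [p pP]] := cokernel_family (Lcomp f) coker.
have fac n : exists d, d ∘ fmap F (p n) = p (n + 1) ∘ Ldiff N n.
  apply: cokernel_desc (hcok _ _ _ _ _ (pP n)) _.
  by rewrite -compmA -LcompP compmA (pP _).1 comp0m.
have [d dE] := dependent_choice fac.
suff dP n : d (n + 1) ∘ fmap F (d n) = zerom A.
  by exists (LObj dP), (@LHom _ _ _ N (LObj dP) p (fun n => esym (dE n))).
apply: (cokernel_epi (hcok _ _ _ _ _ (hcok _ _ _ _ _ (pP n)))).
by rewrite -compmA -fmapM dE fmapM compmA dE -compmA Ldiff2 comp0m compm0.
Qed.

(** Compatibility of u with the differentials is tested after composition with
    F(p^n), which is an epimorphism because F preserves the cokernel p^n. *)
Lemma L_descends :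
  preserves_cokernels A F -> descends_along_cokernels A Lfamily.
Proof.
move=> hcok N Q W p h u coker uE.
suff uP n : u (n + 1) ∘ Ldiff Q n = Ldiff W n ∘ fmap F (u n).
  by exists (LHom uP).
have {}uE m : u m ∘ Lcomp p m = Lcomp h m by apply: uE.
have [X [g pg]] := coker n; apply: (cokernel_epi (hcok _ _ _ _ _ pg)).
change (u (n + 1) ∘ Ldiff Q n ∘ fmap F (Lcomp p n) =
  Ldiff W n ∘ fmap F (u n) ∘ fmap F (Lcomp p n)).
by rewrite -!compmA -fmapM -LcompP compmA !uE LcompP.
Qed.

End Left.

(** The differential of a biproduct is the diagonal one.  It makes the
    injections and projections morphisms, and its square is then computed
    from the squares of d_M and d_N. *)
Lemma L_biproducts (C : category) (A : additive_category C) (F : endofunctor C) :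
  additive_functor A F -> has_termwise_biproducts A (Lfamily A F).
Proof.
move=> hF M N.
have [S [i1 [i2 [p1 [p2 bi]]]]] := biproduct_family A (Lterm M) (Lterm N).
pose d n := addm A (i1 (n + 1) ∘ (Ldiff M n ∘ fmap F (p1 n)))
                   (i2 (n + 1) ∘ (Ldiff N n ∘ fmap F (p2 n))).
have p1d n : p1 (n + 1) ∘ d n = Ldiff M n ∘ fmap F (p1 n).
  have [e1 _ e2 _ _] := bi (n + 1).
  by rewrite comp_addr !(compmA (p1 _)) e1 e2 comp0m comp1m addmm0.
have p2d n : p2 (n + 1) ∘ d n = Ldiff N n ∘ fmap F (p2 n).
  have [_ e1 _ e2 _] := bi (n + 1).
  by rewrite comp_addr !(compmA (p2 _)) e1 e2 comp0m comp1m add0mm.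
have i1d n : i1 (n + 1) ∘ Ldiff M n = d n ∘ fmap F (i1 n).
  have [e1 _ _ e2 _] := bi n.
  by rewrite comp_addl -!compmA -!fmapM e1 e2 fmap0 // fmap1 !compm0 compm1 addmm0.
have i2d n : i2 (n + 1) ∘ Ldiff N n = d n ∘ fmap F (i2 n).
  have [_ e1 e2 _ _] := bi n.
  by rewrite comp_addl -!compmA -!fmapM e1 e2 fmap0 // fmap1 !compm0 compm1 add0mm.
have dP n : d (n + 1) ∘ fmap F (d n) = zerom A.
  rewrite {1}/d comp_addl -!compmA -!fmapM p1d p2d !fmapM.
  by rewrite !(compmA (Ldiff _ _)) !Ldiff2 !comp0m !compm0 addmm0.
by exists (LObj dP), (@LHom _ _ _ M (LObj dP) i1 i1d),
  (@LHom _ _ _ N (LObj dP) i2 i2d), (@LHom _ _ _ (LObj dP) M p1 p1d),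
  (@LHom _ _ _ (LObj dP) N p2 p2d).
Qed.

(** * Right twisted complexes *)

Section Right.
Variables (C : category) (A : preadditive C) (F : endofunctor C).
Hypothesis hF : additive_functor A F.

Definition Rfamily : family_functor (Rcat A F) C :=
  @FamilyFunctor (Rcat A F) C (fun M => Rterm M)
    (fun M N f => @Rcomponent C A F M N f)
    (fun M n => erefl) (fun M N P g f n => erefl) (@Rhom_ext C A F).

Lemma R_subtraction : homs_closed_under_subtraction A Rfamily.
Proof.
split=> [M N|M N f g].
  suff zP n : fmap F (zerom A) ∘ Rdiff M n =
      Rdiff N n ∘ (zerom A : hom (Rterm M n) (Rterm N n)) by exists (RHom zP).
  by rewrite fmap0 // comp0m compm0.
suff sP n : fmap F (subm A (Rcomp f (n + 1)) (Rcomp g (n + 1))) ∘ Rdiff M n =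
    Rdiff N n ∘ subm A (Rcomp f n) (Rcomp g n) by exists (RHom sP).
by rewrite fmap_sub // comp_subl comp_subr !RcompP.
Qed.

Lemma R_scaling (k : comPzRingType) (K : linear_category k A) :
  linear_functor K F -> homs_closed_under_scaling Rfamily K.
Proof.
move=> hK M N a f.
suff sP n : fmap F (scalem K a (Rcomp f (n + 1))) ∘ Rdiff M n =
    Rdiff N n ∘ scalem K a (Rcomp f n) by exists (RHom sP).
by rewrite hK -scalemAl -scalemAr RcompP.
Qed.

Lemma R_zero : (exists Z : C, is_zero_obj Z) -> has_termwise_zero Rfamily.
Proof.
move=> [Z Z0].
pose d (n : int) : hom Z (F Z) := zerom A.
suff dP n : fmap F (d (n + 1)) ∘ d n = zerom A by exists (RObj dP).
exact: compm0.
Qed.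

(** The dual of [L_kernels]: F is only composed on the left of the map to be
    factored, and the epimorphisms that are cancelled are the terms of p. *)
Lemma R_cokernels : has_cokernels A -> has_termwise_cokernels A Rfamily.
Proof.
move=> coker M N f; have [Q [p pP]] := cokernel_family (Rcomp f) coker.
have fac n : exists d, d ∘ p n = fmap F (p (n + 1)) ∘ Rdiff N n.
  apply: cokernel_desc (pP _) _.
  by rewrite -compmA -RcompP compmA -fmapM (pP _).1 fmap0 // comp0m.
have [d dE] := dependent_choice fac.
suff dP n : fmap F (d (n + 1)) ∘ d n = zerom A.
  by exists (RObj dP), (@RHom _ _ _ N (RObj dP) p (fun n => esym (dE n))).
apply: (cokernel_epi (pP _)).
by rewrite -compmA dE compmA -fmapM dE fmapM -compmA Rdiff2 comp0m compm0.
Qed.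

Lemma R_descends : descends_along_cokernels A Rfamily.
Proof.
move=> N Q W p h u coker uE.
suff uP n : fmap F (u (n + 1)) ∘ Rdiff Q n = Rdiff W n ∘ u n.
  by exists (RHom uP).
have {}uE m : u m ∘ Rcomp p m = Rcomp h m by apply: uE.
have [X [g pg]] := coker n; apply: (cokernel_epi pg).
change (fmap F (u (n + 1)) ∘ Rdiff Q n ∘ Rcomp p n =
  Rdiff W n ∘ u n ∘ Rcomp p n).
by rewrite -!compmA uE -!RcompP compmA -fmapM uE.
Qed.

(** The induced map ends at F(K^(n+1)), so it needs F(i^(n+1)) to be a kernel of
    F(f^(n+1)); its square is tested after composition with F(F(i^(n+2))). *)
Lemma R_kernels :
  preserves_kernels A F -> has_kernels A -> has_termwise_kernels A Rfamily.
Proof.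
move=> hker ker M N f; have [K [i iP]] := kernel_family (Rcomp f) ker.
have fac n : exists d, fmap F (i (n + 1)) ∘ d = Rdiff M n ∘ i n.
  apply: kernel_lift (hker _ _ _ _ _ (iP (n + 1))) _.
  by rewrite compmA RcompP -compmA (iP _).1 compm0.
have [d dE] := dependent_choice fac.
suff dP n : fmap F (d (n + 1)) ∘ d n = zerom A.
  by exists (RObj dP), (@RHom _ _ _ (RObj dP) M i dE).
apply: (kernel_mono (hker _ _ _ _ _ (hker _ _ _ _ _ (iP (n + 1 + 1))))).
by rewrite compmA -fmapM dE fmapM -compmA dE compmA Rdiff2 comp0m compm0.
Qed.

(** The two sides end at F(K^(n+1)), so the cancelled monomorphism is
    F(k^(n+1)). *)
Lemma R_lifts : preserves_kernels A F -> lifts_through_kernels A Rfamily.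
Proof.
move=> hker M K W k h u ker uE.
suff uP n : fmap F (u (n + 1)) ∘ Rdiff W n = Rdiff K n ∘ u n.
  by exists (RHom uP).
have {}uE m : Rcomp k m ∘ u m = Rcomp h m by apply: uE.
have [Y [g kg]] := ker (n + 1); apply: (kernel_mono (hker _ _ _ _ _ kg)).
change (fmap F (Rcomp k (n + 1)) ∘ (fmap F (u (n + 1)) ∘ Rdiff W n) =
  fmap F (Rcomp k (n + 1)) ∘ (Rdiff K n ∘ u n)).
by rewrite !compmA -fmapM uE !RcompP -compmA uE.
Qed.

End Right.

Lemma R_biproducts (C : category) (A : additive_category C) (F : endofunctor C) :
  additive_functor A F -> has_termwise_biproducts A (Rfamily A F).
Proof.
move=> hF M N.
have [S [i1 [i2 [p1 [p2 bi]]]]] := biproduct_family A (Rterm M) (Rterm N).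
pose d n := addm A (fmap F (i1 (n + 1)) ∘ (Rdiff M n ∘ p1 n))
                   (fmap F (i2 (n + 1)) ∘ (Rdiff N n ∘ p2 n)).
have p1d n : fmap F (p1 (n + 1)) ∘ d n = Rdiff M n ∘ p1 n.
  have [e1 _ e2 _ _] := bi (n + 1).
  by rewrite comp_addr !(compmA (fmap F (p1 _))) -!fmapM e1 e2 fmap0 // fmap1
    comp0m comp1m addmm0.
have p2d n : fmap F (p2 (n + 1)) ∘ d n = Rdiff N n ∘ p2 n.
  have [_ e1 _ e2 _] := bi (n + 1).
  by rewrite comp_addr !(compmA (fmap F (p2 _))) -!fmapM e1 e2 fmap0 // fmap1
    comp0m comp1m add0mm.
have i1d n : fmap F (i1 (n + 1)) ∘ Rdiff M n = d n ∘ i1 n.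
  have [e1 _ _ e2 _] := bi n.
  by rewrite comp_addl -!compmA e1 e2 !compm0 compm1 addmm0.
have i2d n : fmap F (i2 (n + 1)) ∘ Rdiff N n = d n ∘ i2 n.
  have [_ e1 e2 _ _] := bi n.
  by rewrite comp_addl -!compmA e1 e2 !compm0 compm1 add0mm.
have dP n : fmap F (d (n + 1)) ∘ d n = zerom A.
  rewrite {2}/d comp_addr !(compmA (fmap F (d _))) -!fmapM -i1d -i2d !fmapM.
  by rewrite -!compmA !(compmA _ (Rdiff _ _)) !Rdiff2 !comp0m !compm0 addmm0.
by exists (RObj dP), (@RHom _ _ _ M (RObj dP) i1 i1d),
  (@RHom _ _ _ N (RObj dP) i2 i2d), (@RHom _ _ _ (RObj dP) M p1 p1d),
  (@RHom _ _ _ (RObj dP) N p2 p2d).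
Qed.

(* The group structures on the hom-sets of the four categories are the
   componentwise ones, and (ii)-(vi) refer to them. *)
Theorem theorem3p1 (C : category) (A : additive_category C)
    (F : endofunctor C) (hF : additive_functor A F) :
  exists (AL : additive_category (Lcat A F))
         (ALb : additive_category (Lbcat A F))
         (AR : additive_category (Rcat A F))
         (ARb : additive_category (Rbcat A F)),
    (* (i) *)
    (componentwise_add A (@Lcomponent C A F) AL /\
     componentwise_add A (@Lbcomponent C A F) ALb /\
     componentwise_add A (@Rcomponent C A F) AR /\
     componentwise_add A (@Rbcomponent C A F) ARb) /\
    (* (ii) *)
    (has_kernels A -> has_kernels AL /\ has_kernels ALb) /\
    (* (iii) *)
    (is_abelian A -> preserves_cokernels A F ->
       is_abelian AL /\ is_abelian ALb) /\
    (* (iv) *)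
    (has_cokernels A -> has_cokernels AR /\ has_cokernels ARb) /\
    (* (v) *)
    (is_abelian A -> preserves_kernels A F ->
       is_abelian AR /\ is_abelian ARb) /\
    (* (vi) *)
    (forall (k : comPzRingType) (K : linear_category k A),
       linear_functor K F ->
       exists (KL : linear_category k AL) (KLb : linear_category k ALb)
              (KR : linear_category k AR) (KRb : linear_category k ARb),
         componentwise_scale K (@Lcomponent C A F) KL /\
         componentwise_scale K (@Lbcomponent C A F) KLb /\
         componentwise_scale K (@Rcomponent C A F) KR /\
         componentwise_scale K (@Rbcomponent C A F) KRb).
Proof.
have zA := addcat_zero A.
have [sL sR] := (L_subtraction hF, R_subtraction hF).
have [zL zR] := (L_zero A F zA, R_zero A F zA).
have [bL bR] := (L_biproducts hF, R_biproducts hF).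
have [AL addL] := lift_additive sL zL bL.
have [ALb addLb] := lift_additive (bounded_subtraction sL) (bounded_zero zL)
  (bounded_biproducts bL).
have [AR addR] := lift_additive sR zR bR.
have [ARb addRb] := lift_additive (bounded_subtraction sR) (bounded_zero zR)
  (bounded_biproducts bR).
have lL := @L_lifts C A F; have dR := @R_descends C A F.
exists AL, ALb, AR, ARb; split; first by [].
split=> [ker|].
  have kL := L_kernels hF ker; split.
    exact: termwise_has_kernels addL lL kL.
  exact: termwise_has_kernels addLb (bounded_lifts lL) (bounded_kernels kL).
split=> [abA hcok|].
  have [ker coker _ _] := abA.
  have [kL cL] := (L_kernels hF ker, L_cokernels hcok coker).
  have dL := L_descends hcok; split.
    exact: termwise_abelian addL lL dL kL cL abA.
  exact: termwise_abelian addLb (bounded_lifts lL) (bounded_descends dL)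
    (bounded_kernels kL) (bounded_cokernels cL) abA.
split=> [coker|].
  have cR := R_cokernels hF coker; split.
    exact: termwise_has_cokernels addR dR cR.
  exact: termwise_has_cokernels addRb (bounded_descends dR) (bounded_cokernels cR).
split=> [abA hker|k K hK].
  have [ker coker _ _] := abA.
  have [kR cR] := (R_kernels hker ker, R_cokernels hF coker).
  have lR := R_lifts hker; split.
    exact: termwise_abelian addR lR dR kR cR abA.
  exact: termwise_abelian addRb (bounded_lifts lR) (bounded_descends dR)
    (bounded_kernels kR) (bounded_cokernels cR) abA.
have [KL KLE] := lift_linear_scale addL (L_scaling hK).
have [KLb KLbE] := lift_linear_scale addLb (bounded_scaling (L_scaling hK)).
have [KR KRE] := lift_linear_scale addR (R_scaling hK).
have [KRb KRbE] := lift_linear_scale addRb (bounded_scaling (R_scaling hK)).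
by exists KL, KLb, KR, KRb.
Qed.
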